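(* The integral symplectic group $\mathrm{Sp}(2g,\mathbb{Z})$ is generated by three involutions if $g\geq 8$, and by four involutions if $g\geq 3$.
   Context: An involution in a group is an element of order $2$. $\mathrm{Sp}(2g,\mathbb{Z})$ is the group of $2g\times 2g$ integer matrices preserving the standard symplectic form on $\mathbb{Z}^{2g}$. *)

(* Defs.v *)
From HB Require Import structures.
From mathcomp Require Import all_boot all_order all_algebra.

Set Implicit Arguments.
Unset Strict Implicit.
Unset Printing Implicit Defensive.

Import GRing.Theory.

Section Generation.
Local Open Scope group_scope.
Variable G : groupType.

Definition involution : pred G := [pred x | (x != 1) && (x ^+ 2 == 1)].

Inductive generated (s : seq G) : G -> Prop :=
| generated_mem x : x \in s -> generated s x
| generated_one : generated s 1
| generated_mul x y : generated s x -> generated s y -> generated s (x * y)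
| generated_inv x : generated s x -> generated s x^-1.

(* The n involutions are required to be pairwise distinct. *)
Definition generated_by_involutions (n : nat) : Prop :=
  exists s : n.-tuple G,
    [/\ uniq s, all involution s & forall x : G, generated s x].

End Generation.

Arguments generated_by_involutions : clear implicits.

Section Symplectic.
Local Open Scope ring_scope.
Variable g : nat.

(* Gram matrix of the standard symplectic form in the basis
   a_0, ..., a_(g-1), b_0, ..., b_(g-1), with <a_i, b_j> = delta_ij. *)
Definition symp_form : 'M[int]_(g + g) := block_mx 0 1%:M (- 1%:M) 0.

Definition symplectic : pred 'M[int]_(g + g) :=
  [pred A | A^T *m symp_form *m A == symp_form].

Record Sp := MkSp { Sp_mx :> 'M[int]_(g + g); Sp_mxP : symplectic Sp_mx }.

HB.instance Definition _ := [isSub for Sp_mx].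
HB.instance Definition _ := [Choice of Sp by <:].

Lemma symp_form_sqr : symp_form *m symp_form = - 1%:M.
Proof.
rewrite /symp_form mulmx_block !mulmx0 !mul0mx !mulmx1 !add0r !addr0 mul1mx.
by rewrite [1%:M in RHS]scalar_mx_block opp_block_mx !oppr0.
Qed.

Lemma symplectic_mulVmx (A : 'M[int]_(g + g)) :
  symplectic A -> (- (symp_form *m A^T *m symp_form)) *m A = 1%:M.
Proof.
move=> /eqP AJA; rewrite mulNmx -!mulmxA (mulmxA A^T) AJA.
by rewrite symp_form_sqr opprK.
Qed.

Lemma symplectic_unit (A : 'M[int]_(g + g)) : symplectic A -> A \in unitmx.
Proof. by move=> /symplectic_mulVmx /mulmx1_unit[]. Qed.

Lemma symplectic1 : symplectic 1%:M.
Proof. by rewrite /symplectic /= trmx1 mul1mx mulmx1. Qed.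

Lemma symplecticM (A B : 'M[int]_(g + g)) :
  symplectic A -> symplectic B -> symplectic (A *m B).
Proof.
move=> /eqP AJA /eqP BJB; apply/eqP.
have -> : (A *m B)^T *m symp_form *m (A *m B)
            = B^T *m (A^T *m symp_form *m A) *m B.
  by rewrite trmx_mul !mulmxA.
by rewrite AJA.
Qed.

Lemma symplecticV (A : 'M[int]_(g + g)) :
  symplectic A -> symplectic (invmx A).
Proof.
move=> SA; have uA := symplectic_unit SA; apply/eqP.
rewrite -{1}(eqP SA) !mulmxA -trmx_mul mulmxV // trmx1 mul1mx.
by rewrite -mulmxA mulmxV // mulmx1.
Qed.

Definition Sp_one : Sp := MkSp symplectic1.
Definition Sp_mul (A B : Sp) : Sp := MkSp (symplecticM (Sp_mxP A) (Sp_mxP B)).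
Definition Sp_inv (A : Sp) : Sp := MkSp (symplecticV (Sp_mxP A)).

Lemma Sp_mulA : associative Sp_mul.
Proof. by move=> A B C; apply: val_inj; rewrite /= mulmxA. Qed.

Lemma Sp_mul1x : left_id Sp_one Sp_mul.
Proof. by move=> A; apply: val_inj; rewrite /= mul1mx. Qed.

Lemma Sp_mulx1 : right_id Sp_one Sp_mul.
Proof. by move=> A; apply: val_inj; rewrite /= mulmx1. Qed.

Lemma Sp_mulVx : left_inverse Sp_one Sp_inv Sp_mul.
Proof.
by move=> A; apply: val_inj; rewrite /= mulVmx // symplectic_unit ?Sp_mxP.
Qed.

Lemma Sp_mulxV : right_inverse Sp_one Sp_inv Sp_mul.
Proof.
by move=> A; apply: val_inj; rewrite /= mulmxV // symplectic_unit ?Sp_mxP.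
Qed.

HB.instance Definition _ :=
  isGroup.Build Sp Sp_mulA Sp_mul1x Sp_mulx1 Sp_mulVx Sp_mulxV.

End Symplectic.

(* Main.v *)
(* Let H be the subgroup generated by two reflections of the cycle of indices
   and the further involutions.  Over the order 6 element h_i of SL_2(Z) acting
   on the i-th hyperbolic plane, a swap of two indices twisted by h_i multiplied
   by its mirror image gives, after squaring, h_i^4 h_j^-4; with three
   involutions the disjoint factor [flip] cancels here, being an involution that
   commutes with its mirror image, and g >= 8 leaves room for disjoint supports.
   The involution [flip], which sends a_1 to a_1 - a_0, then turns these rotations
   into short root elements by commutators, and a relation in the Heisenberg
   group of a_2 isolates one transvection.  Moving it around gives the
   transvections along all a_i and b_i and all short root elements, and these
   generate Sp(2g, Z) by the Euclidean algorithm applied to the images of the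
   basis vectors. *)

Require Import Defs.
From mathcomp Require Import all_boot all_order all_algebra.
From mathcomp Require Import fingroup perm zify ring.

Set Implicit Arguments.
Unset Strict Implicit.
Unset Printing Implicit Defensive.

(* [fingroup] has its own [generated]. *)
Import Defs.
Import Order.TTheory GRing.Theory Num.Theory.

(** * Transvections and short root elements *)

Section SymplecticAction.
Local Open Scope ring_scope.
Variable g : nat.
Local Notation V := 'cV[int]_(g + g).
Local Notation J := (symp_form g).
Implicit Types (u v w x y : V) (A B : Sp g) (i j : 'I_g) (n m : int).

(** * The symplectic form, the standard basis and the action on vectors *)

Definition om u v : int := (u^T *m J *m v) 0 0.
Definition act A v : V := Sp_mx A *m v.
Definition ea i : V := col_mx (delta_mx i 0) 0.
Definition eb i : V := col_mx 0 (delta_mx i 0).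

Lemma om_scalar u v : u^T *m J *m v = (om u v)%:M.
Proof. by rewrite [LHS]mx11_scalar. Qed.

Lemma omDl u v w : om (u + v) w = om u w + om v w.
Proof. by rewrite /om linearD /= !mulmxDl mxE. Qed.
Lemma omDr u v w : om w (u + v) = om w u + om w v.
Proof. by rewrite /om mulmxDr mxE. Qed.
Lemma omZl n u v : om (n *: u) v = n * om u v.
Proof. by rewrite /om linearZ /= -!scalemxAl mxE. Qed.
Lemma omZr n u v : om u (n *: v) = n * om u v.
Proof. by rewrite /om -scalemxAr mxE. Qed.
Lemma omNl u v : om (- u) v = - om u v.
Proof. by rewrite -scaleN1r omZl mulN1r. Qed.
Lemma omNr u v : om u (- v) = - om u v.
Proof. by rewrite -scaleN1r omZr mulN1r. Qed.
Lemma om0l v : om 0 v = 0.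
Proof. by rewrite -(scale0r (0 : V)) omZl mul0r. Qed.
Lemma om0r v : om v 0 = 0.
Proof. by rewrite -(scale0r (0 : V)) omZr mul0r. Qed.
Definition omE := (omDl, omDr, omZl, omZr, omNl, omNr, om0l, om0r).

Lemma tr_symp_form : J^T = - J.
Proof.
by rewrite /symp_form tr_block_mx opp_block_mx !trmx0 linearN /= trmx1 !oppr0 opprK.
Qed.

Lemma om_sym u v : om v u = - om u v.
Proof.
rewrite /om -[in LHS](trmxK (_ *m u)) mxE !trmx_mul trmxK tr_symp_form.
by rewrite mulNmx mulmxN mxE mulmxA.
Qed.

Lemma omxx v : om v v = 0.
Proof. by have := om_sym v v; lia. Qed.

Lemma om_col_mx (p q r s : 'cV[int]_g) :
  om (col_mx p q) (col_mx r s) = (p^T *m s) 0 0 - (q^T *m r) 0 0.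
Proof.
rewrite /om /symp_form tr_col_mx -mulmxA mul_block_col mul_row_col.
by rewrite !mul0mx mul1mx add0r addr0 mulNmx mul1mx mulmxN !mxE.
Qed.

Lemma tr_mul_delta (p : 'cV[int]_g) i : (p^T *m (delta_mx i 0 : 'cV[int]_g)) 0 0 = p i 0.
Proof. by rewrite -colE !mxE. Qed.

Lemma om_col_a (p q : 'cV[int]_g) i : om (col_mx p q) (ea i) = - q i 0.
Proof. by rewrite om_col_mx mulmx0 tr_mul_delta mxE sub0r. Qed.
Lemma om_col_b (p q : 'cV[int]_g) i : om (col_mx p q) (eb i) = p i 0.
Proof. by rewrite om_col_mx mulmx0 tr_mul_delta [X in _ - X]mxE subr0. Qed.

Lemma om_ab i j : om (ea i) (eb j) = (i == j)%:R.
Proof. by rewrite om_col_b mxE andbT eq_sym. Qed.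
Lemma om_ba i j : om (eb i) (ea j) = - (i == j)%:R.
Proof. by rewrite om_sym om_ab eq_sym. Qed.
Lemma om_aa i j : om (ea i) (ea j) = 0.
Proof. by rewrite om_col_a mxE oppr0. Qed.
Lemma om_bb i j : om (eb i) (eb j) = 0.
Proof. by rewrite om_col_b mxE. Qed.
Lemma om_ab1 i : om (ea i) (eb i) = 1. Proof. by rewrite om_ab eqxx. Qed.
Lemma om_ba1 i : om (eb i) (ea i) = -1. Proof. by rewrite om_ba eqxx. Qed.
Definition omB := (om_ab1, om_ba1, om_ab, om_ba, om_aa, om_bb).

Lemma om_vb v i : om v (eb i) = v (lshift g i) 0.
Proof. by rewrite -[in LHS](vsubmxK v) om_col_b !mxE. Qed.
Lemma om_av v i : om (ea i) v = v (rshift g i) 0.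
Proof. by rewrite om_sym -[in LHS](vsubmxK v) om_col_a !mxE opprK. Qed.

Lemma vec_dec v : v = \sum_i (om v (eb i) *: ea i + om (ea i) v *: eb i).
Proof.
apply/matrixP => k l; rewrite summxE (ord1 l).
case: (split_ordP k) => i ->; rewrite (bigD1 i) //= big1 => [|j ji]; rewrite ?om_vb ?om_av.
- by rewrite !(col_mxEu, mxE) !eqxx mulr1 mulr0 !addr0.
- by rewrite !(col_mxEu, mxE) eq_sym (negPf ji) !mulr0 addr0.
- by rewrite !(col_mxEd, mxE) !eqxx mulr1 mulr0 !addr0 add0r.
- by rewrite !(col_mxEd, mxE) eq_sym (negPf ji) !mulr0 addr0.
Qed.

Lemma act1 v : act 1%g v = v.
Proof. exact: mul1mx. Qed.
Lemma actM A B v : act (A * B)%g v = act A (act B v).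
Proof. by rewrite /act /= mulmxA. Qed.
Lemma actVK A v : act A^-1%g (act A v) = v.
Proof. by rewrite -actM mulVg act1. Qed.
Lemma actKV A v : act A (act A^-1%g v) = v.
Proof. by rewrite -actM mulgV act1. Qed.
Lemma actD A u v : act A (u + v) = act A u + act A v.
Proof. exact: mulmxDr. Qed.
Lemma actZ A n v : act A (n *: v) = n *: act A v.
Proof. by rewrite /act scalemxAr. Qed.
Lemma actN A v : act A (- v) = - act A v.
Proof. exact: mulmxN. Qed.
Lemma act0 A : act A 0 = 0.
Proof. exact: mulmx0. Qed.
Definition actE := (actD, actZ, actN, act0).

Lemma om_act A u v : om (act A u) (act A v) = om u v.
Proof.
have /eqP AJA : A^T *m J *m A == J := Sp_mxP A.
rewrite /om /act trmx_mul; congr (_ 0 0).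
by rewrite -[in RHS]AJA !mulmxA.
Qed.

Lemma act_ext A B : (forall v, act A v = act B v) -> A = B.
Proof.
move=> eqAB; apply: val_inj; apply/matrixP => i j.
by have /matrixP/(_ i 0) := eqAB (delta_mx j 0); rewrite /act -!colE !mxE.
Qed.

Lemma act_eq A B : (forall i, act A (ea i) = act B (ea i)) ->
  (forall i, act A (eb i) = act B (eb i)) -> A = B.
Proof.
move=> ha hb; apply: act_ext => v; rewrite (vec_dec v) /act !mulmx_sumr.
by apply: eq_bigr => i _; rewrite -!/(act _ _) !actE ha hb.
Qed.

(** * Transvections, short root elements and their conjugates *)

Definition transv_mx n v : 'M[int]_(g + g) := 1%:M + n *: (v *m (v^T *m J)).

Lemma transv_mxE n v x : transv_mx n v *m x = x + (n * om v x) *: v.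
Proof.
rewrite /transv_mx mulmxDl mul1mx -scalemxAl -!mulmxA [v^T *m _]mulmxA om_scalar.
by rewrite mul_mx_scalar scalerA.
Qed.

Lemma om_mx_symplectic (C : 'M[int]_(g + g)) :
  (forall x y, om (C *m x) (C *m y) = om x y) -> symplectic C.
Proof.
move=> hC; apply/eqP/matrixP => i j.
have entry (D : 'M[int]_(g + g)) : D i j = (row i D *m (delta_mx j 0 : V)) 0 0.
  by rewrite -colE !mxE.
rewrite [LHS]entry [RHS]entry !rowE -trmx_delta.
have := hC (delta_mx i 0) (delta_mx j 0).
by rewrite /om trmx_mul !mulmxA.
Qed.

Lemma transv_symplectic n v : symplectic (transv_mx n v).
Proof.
apply: om_mx_symplectic => x y; rewrite !transv_mxE !omE omxx.
by rewrite (om_sym v x); ring.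
Qed.

Definition transv n v : Sp g := MkSp (transv_symplectic n v).

Lemma act_transv n v x : act (transv n v) x = x + (n * om v x) *: v.
Proof. exact: transv_mxE. Qed.

Lemma transv_conj A n v : (A * transv n v * A^-1)%g = transv n (act A v).
Proof.
apply: act_ext => x; rewrite !actM !act_transv actD actZ actKV.
by rewrite -(om_act A v) actKV.
Qed.

Lemma transvD n m v : (transv n v * transv m v)%g = transv (n + m) v.
Proof.
apply: act_ext => x; rewrite !actM !act_transv !omE omxx mulr0 addr0 -addrA -scalerDl.
by congr (_ + _ *: _); ring.
Qed.

Lemma transv0 v : transv 0 v = 1%g.
Proof. by apply: act_ext => x; rewrite act_transv mul0r scale0r addr0 act1. Qed.

Lemma transvV n v : (transv n v)^-1%g = transv (- n) v.
Proof. by apply: mulg1_eq; rewrite transvD subrr transv0. Qed.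

Lemma transv_fix n v x : om v x = 0 -> act (transv n v) x = x.
Proof. by move=> vx; rewrite act_transv vx mulr0 scale0r addr0. Qed.

(* Locked, as [hexa] below, lest [actM] unfold it into its factors. *)
Definition eich u v : Sp g :=
  locked (transv 1 (u + v) * transv (-1) u * transv (-1) v)%g.

(** The square terms of the three transvections cancel and the mixed ones remain: for orthogonal [u]
    and [v] this is the Eichler transformation. *)
Lemma act_eich u v x : om u v = 0 ->
  act (eich u v) x = x + om u x *: v + om v x *: u.
Proof.
move=> uv; have vu : om v u = 0 by rewrite om_sym uv oppr0.
rewrite /eich -lock !actM !act_transv !omE !omxx uv vu.
by apply/matrixP => i j; rewrite !mxE; ring.
Qed.

Lemma eich_conj A u v : (A * eich u v * A^-1)%g = eich (act A u) (act A v).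
Proof. by rewrite /eich -!lock -actD -!transv_conj !mulgA !mulgKV. Qed.

Lemma eichC u v : om u v = 0 -> eich u v = eich v u.
Proof.
move=> uv; have vu : om v u = 0 by rewrite om_sym uv oppr0.
by apply: act_ext => x; rewrite !act_eich // addrAC.
Qed.

(** Multiplication in the Heisenberg group of [u]: its centre consists of the transvections along
    [u], and the form is the cocycle. *)
Lemma eichD u v w : om u v = 0 -> om u w = 0 ->
  (eich u v * eich u w)%g = (eich u (v + w) * transv (om v w) u)%g.
Proof.
move=> uv uw; have vu : om v u = 0 by rewrite om_sym uv oppr0.
have wu : om w u = 0 by rewrite om_sym uw oppr0.
apply: act_ext => x; rewrite !actM !act_eich ?omE ?uv ?uw // act_transv
  !omE !omxx ?uv ?uw ?vu ?wu.
by apply/matrixP => i j; rewrite !mxE; ring.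
Qed.

Lemma eichV u v : om u v = 0 -> (eich u v)^-1%g = eich u (- v).
Proof.
move=> uv; apply: mulg1_eq; rewrite eichD ?omE ?uv ?oppr0 // omxx oppr0 transv0 mulg1.
apply: act_ext => x; rewrite subrr act_eich ?omE //.
by rewrite scaler0 scale0r !addr0 act1.
Qed.

Lemma eich_add u v w : om u v = 0 -> om u w = 0 -> om v w = 0 ->
  eich u (v + w) = (eich u v * eich u w)%g.
Proof. by move=> uv uw vw; rewrite eichD // vw transv0 mulg1. Qed.

Lemma fix_commute A n v : act A v = v -> commute A (transv n v).
Proof. by move=> Av; rewrite /commute -[in RHS]Av -transv_conj mulgKV. Qed.


(* Of order 6: on the plane of [ea i] and [eb i] it is [[0, 1], [-1, 1]]. *)
Definition hexa i : Sp g := locked (transv 1 (ea i) * transv 1 (eb i))%g.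

Lemma act_hexa_a i : act (hexa i) (ea i) = - eb i.
Proof.
rewrite /hexa -lock actM !act_transv !omE !omB.
by apply/matrixP => k l; rewrite !mxE; ring.
Qed.

Lemma act_hexa_b i : act (hexa i) (eb i) = ea i + eb i.
Proof.
rewrite /hexa -lock actM !act_transv !omE !omB.
by apply/matrixP => k l; rewrite !mxE; ring.
Qed.

Lemma act_hexa_fix i x : om (ea i) x = 0 -> om (eb i) x = 0 -> act (hexa i) x = x.
Proof. by move=> ax bx; rewrite /hexa -lock actM !transv_fix. Qed.

Lemma act_expg_fix A k x : act A x = x -> act (A ^+ k)%g x = x.
Proof. by move=> Ax; elim: k => [|k IHk]; rewrite ?act1 // expgS actM IHk. Qed.

Definition hexaE := (expgS, actM, act_hexa_a, act_hexa_b, actE, act1, expg0).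

(** On its plane [hexa i] has cube minus the identity, while its fourth power has order 3 and cycles
    [ea i], [eb i] and [- ea i - eb i], three vectors of sum zero. *)
Lemma act_hexa3_a i : act (hexa i ^+ 3)%g (ea i) = - ea i.
Proof. by rewrite !hexaE; apply/matrixP => k l; rewrite !mxE; ring. Qed.
Lemma act_hexa3_b i : act (hexa i ^+ 3)%g (eb i) = - eb i.
Proof. by rewrite !hexaE; apply/matrixP => k l; rewrite !mxE; ring. Qed.
Lemma act_hexa4_a i : act (hexa i ^+ 4)%g (ea i) = eb i.
Proof. by rewrite !hexaE; apply/matrixP => k l; rewrite !mxE; ring. Qed.
Lemma act_hexa4_b i : act (hexa i ^+ 4)%g (eb i) = - ea i - eb i.
Proof. by rewrite !hexaE; apply/matrixP => k l; rewrite !mxE; ring. Qed.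

(** Inverted so that vectors of index [i] go to those of index [s i]. *)
Definition perm_sp_mx (s : 'S_g) : 'M[int]_(g + g) :=
  block_mx (perm_mx s^-1) 0 0 (perm_mx s^-1).

Lemma perm_sp_symplectic s : symplectic (perm_sp_mx s).
Proof.
rewrite /symplectic /=  /perm_sp_mx tr_block_mx !trmx0 !tr_perm_mx invgK /symp_form.
rewrite !mulmx_block !mulmx0 !mul0mx !addr0 !add0r !mul0mx mulmxN mulNmx !mulmx1.
by rewrite -!perm_mxM mulgV perm_mx1.
Qed.

Definition perm_sp s : Sp g := MkSp (perm_sp_symplectic s).

Lemma perm_mx_delta (s : 'S_g) i :
  perm_mx s^-1 *m (delta_mx i 0 : 'cV[int]_g) = delta_mx (s i) 0.
Proof.
rewrite -row_permE; apply/matrixP => k l; rewrite !mxE.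
by rewrite (can2_eq (permKV s) (permK s)).
Qed.

Lemma act_perm_a s i : act (perm_sp s) (ea i) = ea (s i).
Proof.
by rewrite /act /= /perm_sp_mx mul_block_col !mul0mx mulmx0 !addr0 perm_mx_delta.
Qed.

Lemma act_perm_b s i : act (perm_sp s) (eb i) = eb (s i).
Proof.
by rewrite /act /= /perm_sp_mx mul_block_col !mul0mx mulmx0 !add0r perm_mx_delta.
Qed.

Lemma perm_hexa s i : (perm_sp s * hexa i * (perm_sp s)^-1)%g = hexa (s i).
Proof.
rewrite /hexa -!lock -act_perm_a -act_perm_b -!transv_conj !mulgA.
by rewrite mulgKV.
Qed.

End SymplecticAction.

(** * Generation by elementary elements *)

(** Subtractive Euclid: a step adds plus or minus one coordinate to the other, so that one
    elementary element or its inverse realises it. *)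
Lemma euclid_ind (P : int -> int -> Prop) :
  (forall n x y : int, (n = 1 \/ n = -1)%R -> P (x + n * y)%R y -> P x y) ->
  (forall n x y : int, (n = 1 \/ n = -1)%R -> P x (y + n * x)%R -> P x y) ->
  (forall d, P d 0%R) -> forall x y, P x y.
Proof.
move=> Px Py P0 x y.
have [k] := ubnP (`|x| + `|y|)%N; elim: k x y => // k IHk x y.
have [-> //|y0 lek] := eqVneq y 0%R.
have [x0|x0] := eqVneq x 0%R.
  (* The surviving coordinate has to be the first, so [(0, y)] goes through [(y, y)] to [(y, 0)]. *)
  apply: (Px 1%R); first by left.
  apply: (Py (-1)%R); first by right.
  by rewrite x0 add0r mul1r mulN1r subrr.
have [le|lt] := leqP `|y| `|x|.
- have [yx|yx] : (`|(x + y)%R| < `|x|)%N \/ (`|(x - y)%R| < `|x|)%N by lia.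
    by apply: (Px 1%R); [left | apply: IHk; lia].
  by apply: (Px (-1)%R); [right | apply: IHk; lia].
- have [yx|yx] : (`|(y + x)%R| < `|y|)%N \/ (`|(y - x)%R| < `|y|)%N by lia.
    by apply: (Py 1%R); [left | apply: IHk; lia].
  by apply: (Py (-1)%R); [right | apply: IHk; lia].
Qed.

Ltac vec_ring := apply/matrixP => ? ?; rewrite !mxE; ring.

(** * Closure properties of the generated subgroup *)

Section Generated.
Local Open Scope group_scope.
Variables (G : groupType) (S : seq G).

Lemma generatedX x n : generated S x -> generated S (x ^+ n).
Proof.
move=> Hx; elim: n => [|n IHn]; first exact: generated_one.
by rewrite expgS; apply: generated_mul.
Qed.

Lemma generated_conj x y : generated S x -> generated S y -> generated S (x * y * x^-1).
Proof.
by move=> Hx Hy; apply: generated_mul; [apply: generated_mul | apply: generated_inv].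
Qed.

Lemma generated_cancel x y : generated S x -> generated S (x * y) -> generated S y.
Proof.
move=> Hx Hxy; rewrite -(mulKg x y).
by apply: generated_mul => //; apply: generated_inv.
Qed.

End Generated.

(** * Transvections and short root elements generate Sp(2g, Z) *)

Section ElementaryGeneration.
Local Open Scope ring_scope.
Variable g : nat.
Local Notation V := 'cV[int]_(g + g).
Variable S : seq (Sp g).
Local Notation H := (generated S).
Implicit Types (u v w x y : V) (A B : Sp g) (i j : 'I_g) (n : int).

Lemma generated_transv n v : H (transv 1 v) -> H (transv n v).
Proof.
move=> H1; elim/int_rect: n => [|n IHn|n IHn]; first by rewrite transv0; apply: generated_one.
  by rewrite intS -transvD; apply: generated_mul.
rewrite intS opprD -transvD; apply: generated_mul => //.
by rewrite -transvV; apply: generated_inv.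
Qed.

Lemma generated_hexa i : H (transv 1 (ea i)) -> H (transv 1 (eb i)) -> H (hexa i).
Proof. by rewrite /hexa -lock; apply: generated_mul. Qed.

(** Conjugation by [hexa j] fixes [ea i] and turns [ea j] into [- eb j]. *)
Lemma generated_eich_ab i j : i != j -> H (transv 1 (ea j)) -> H (transv 1 (eb j)) ->
  H (eich (ea i) (ea j)) -> H (eich (ea i) (eb j)).
Proof.
move=> ij Hj Hj' Hij.
have := generated_conj (generated_hexa Hj Hj') Hij.
rewrite eich_conj act_hexa_a act_hexa_fix ?omB 1?eq_sym ?(negPf ij) ?oppr0 //.
by rewrite -eichV ?omB ?(negPf ij) // => /generated_inv; rewrite invgK.
Qed.

Hypothesis Ha : forall i, H (transv 1 (ea i)).
Hypothesis Hb : forall i, H (transv 1 (eb i)).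
Hypothesis Haa : forall i j, i != j -> H (eich (ea i) (ea j)).

(** The admissible [v] are closed under sums, because the Heisenberg defect is a transvection along
    [ea i], already in [H]. They contain the basis vectors of all other planes. *)
Lemma generated_eich_span i v : om (ea i) v = 0 -> om (eb i) v = 0 -> H (eich (ea i) v).
Proof.
move=> av bv; pose Q w := om (ea i) w = 0 /\ H (eich (ea i) w).
have QD u w : Q u -> Q w -> Q (u + w).
  move=> [iu Hu] [iw Hw]; split; first by rewrite omE iu iw addr0.
  have -> : eich (ea i) (u + w) =
      (eich (ea i) u * eich (ea i) w * transv (- om u w) (ea i))%g.
    by rewrite eichD // -transvV mulgK.
  by apply: generated_mul; [apply: generated_mul | apply: generated_transv].
have QN w : Q w -> Q (- w).
  by move=> [iw Hw]; split; rewrite ?omE ?iw ?oppr0 // -eichV //; apply: generated_inv.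
have Q0 w : Q w -> Q 0 by move=> Qw; rewrite -(subrr w); apply: QD => //; apply: QN.
have QZ n w : Q w -> Q (n *: w).
  move=> Qw; elim/int_rect: n => [|n IHn|n IHn].
  - by rewrite scale0r; apply: Q0 Qw.
  - by rewrite intS scalerDl scale1r; apply: QD.
  - by rewrite intS opprD scalerDl scaleN1r; apply: QD => //; apply: QN.
have Qz : Q 0.
  split; first by rewrite omE.
  suff -> : eich (ea i) 0 = 1%g by exact: generated_one.
  by apply: act_ext => x; rewrite act_eich ?omE // scaler0 scale0r !addr0 act1.
suff: Q v by case.
rewrite (vec_dec v); apply: big_ind => // j _.
have [->|ij] := eqVneq j i; first by rewrite om_sym bv av oppr0 !scale0r addr0.
apply: QD; apply: QZ; split; rewrite ?omB 1?eq_sym ?(negPf ij) //.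
  by apply: Haa; rewrite eq_sym.
by apply: generated_eich_ab => //; [rewrite eq_sym | apply: Haa; rewrite eq_sym].
Qed.

(** * Reducing vectors while the first [k] planes stay fixed *)

Definition fixes k A := forall i, (i < k)%N -> act A (ea i) = ea i /\ act A (eb i) = eb i.
Definition supported k v := forall i, (i < k)%N -> om (ea i) v = 0 /\ om (eb i) v = 0.

Definition orb k v w := exists A, [/\ H A, fixes k A & act A v = w].

Lemma orb_refl k v : orb k v v.
Proof.
exists 1%g; split; rewrite ?act1 //; first exact: generated_one.
by move=> i _; rewrite !act1.
Qed.

Lemma orb_trans k u v w : orb k u v -> orb k v w -> orb k u w.
Proof.
move=> [A [HA fA Au]] [B [HB fB Bv]]; exists (B * A)%g; split.
- exact: generated_mul.
- by move=> i ik; rewrite !actM; have [-> ->] := fA i ik; apply: fB.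
- by rewrite actM Au.
Qed.

Lemma orb_transv k u n v : H (transv 1 u) -> supported k u ->
  orb k v (v + (n * om u v) *: u).
Proof.
move=> Hu su; exists (transv n u); split; rewrite ?act_transv //.
  exact: generated_transv.
by move=> i /su[au bu]; rewrite !transv_fix // om_sym ?au ?bu oppr0.
Qed.

Lemma orb_eich k u w n v : (n = 1 \/ n = -1)%R -> om u w = 0 -> H (eich u w) ->
  supported k u -> supported k w ->
  orb k v (v + (n * om u v) *: w + (n * om w v) *: u).
Proof.
move=> n1 uw Huw su sw.
have unw : om u (n *: w) = 0 by rewrite omE uw mulr0.
exists (eich u (n *: w)); split.
- case: n1 => ->; rewrite ?scale1r ?scaleN1r // -eichV //.
  exact: generated_inv.
- move=> i ik; have [[au bu] [aw bw]] := (su i ik, sw i ik).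
  rewrite !act_eich // !omE (om_sym (ea i)) (om_sym (eb i)) (om_sym (ea i) w).
  by rewrite (om_sym (eb i) w) au bu aw bw oppr0 !mulr0 !scale0r !addr0.
- by rewrite act_eich // !omE scalerA mulrC.
Qed.

Lemma orb_supported k v w : orb k v w -> supported k v -> supported k w.
Proof.
move=> [A [_ fA <-]] sv i ik; have [fa fb] := fA i ik.
by rewrite -{1}fa -{1}fb !om_act; apply: sv.
Qed.

Lemma supported_basis k i : (k <= i)%N -> supported k (ea i) /\ supported k (eb i).
Proof.
move=> ki; split=> j jk; rewrite !omB; have -> : (j == i) = false.
- by apply/negbTE/eqP => ji; move: jk; rewrite ji ltnNge ki.
- by rewrite oppr0.
- by apply/negbTE/eqP => ji; move: jk; rewrite ji ltnNge ki.
- by [].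
Qed.

(** Euclid on the two coordinates in plane [i], whose transvections act as the elementary matrices
    of SL_2(Z). *)
Lemma orb_kill_b k i : (k <= i)%N -> forall x y : int, forall v,
  om (ea i) v = 0 -> om (eb i) v = 0 ->
  exists d : int, orb k (x *: ea i + y *: eb i + v) (d *: ea i + v).
Proof.
move=> ki x y; have [sa sb] := supported_basis ki.
move: x y; apply: euclid_ind => [n x y n1 IH|n x y n1 IH|d] v av bv.
- have [d o] := IH v av bv; exists d; apply: orb_trans o.
  have := orb_transv n (x *: ea i + y *: eb i + v) (Ha i) sa.
  rewrite !omE !omB av mulr0 add0r addr0 mulr1.
  by congr orb; move: (ea i) (eb i) => a b; vec_ring.
- have [d o] := IH v av bv; exists d; apply: orb_trans o.
  (* The sign compensates [om (eb i) (ea i) = -1]. *)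
  have := orb_transv (- n) (x *: ea i + y *: eb i + v) (Hb i) sb.
  rewrite !omE !omB bv mulr0 !addr0 mulrN1 mulrNN.
  by congr orb; move: (ea i) (eb i) => a b; vec_ring.
- by exists d; rewrite scale0r addr0; apply: orb_refl.
Qed.

(** [om (ea i) w] is the [eb i] coordinate of [w]. The planes are treated one after the other; those
    below [k] need no move, by the support condition. *)
Lemma orb_clear_b k v : supported k v ->
  exists w, orb k v w /\ forall i, om (ea i) w = 0.
Proof.
move=> sv.
suff partial m : (m <= g)%N ->
    exists w, orb k v w /\ forall i, (i < m)%N -> om (ea i) w = 0.
  by have [w [ovw w0]] := partial g (leqnn g); exists w; split=> // i; apply: w0.
elim: m => [|m IHm] mg; first by exists v; split=> //; apply: orb_refl.
have [w [ovw w0]] := IHm (ltnW mg).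
pose i := Ordinal mg; have sw := orb_supported ovw sv.
have [ki|ik] := leqP k i; last first.
  exists w; split=> // j; rewrite ltnS leq_eqVlt => /orP[/eqP ji|]; last exact: w0.
  by have -> : j = i; [apply: val_inj | have [] := sw i ik].
pose x := om w (eb i); pose y := om (ea i) w.
have [d o] := orb_kill_b ki x y (v := w - x *: ea i - y *: eb i)
  ltac:(by rewrite !omE !omB -/y; ring) ltac:(by rewrite !omE !omB om_sym -/x; ring).
exists (d *: ea i + (w - x *: ea i - y *: eb i)); split.
  apply: orb_trans ovw _; move: o; congr orb.
  by move: (ea i) (eb i) => a b; vec_ring.
move=> j; rewrite ltnS leq_eqVlt !omE !omB => /orP[/eqP ji|jm].
  have -> : j = i by apply: val_inj.
  by rewrite eqxx -/y /=; ring.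
rewrite w0 //; have -> : (j == i) = false by apply/negbTE; rewrite neq_ltn jm.
by rewrite /=; ring.
Qed.

(** Once all [eb] coordinates vanish, [eich (ea p) (eb i)] only changes the [ea p] coordinate, by a
    multiple of the [ea i] one, and symmetrically. Euclid then gathers everything at index [p]. *)
Lemma orb_clear_a k (p : 'I_g) v : p = k :> nat -> supported k v ->
  (forall i, om (ea i) v = 0) -> exists d : int, orb k v (d *: ea p).
Proof.
move=> pk sv v0.
suff partial m : (m <= g)%N -> exists w, [/\ orb k v w, forall i, om (ea i) w = 0 &
    forall i, (i < m)%N -> i != p -> om (eb i) w = 0].
  have [w [ovw wa wb]] := partial g (leqnn g); exists (om w (eb p)); move: ovw; congr orb.
  rewrite {1}(vec_dec w) (bigD1 p) //= big1 ?addr0 ?wa ?scale0r ?addr0 // => i ip.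
  by rewrite wa om_sym wb // oppr0 !scale0r addr0.
elim: m => [|m IHm] mg; first by exists v; split=> //; apply: orb_refl.
have [w [ovw wa wb]] := IHm (ltnW mg).
pose i := Ordinal mg; have sw := orb_supported ovw sv.
have [ip|ip] := eqVneq i p.
  exists w; split=> // j; rewrite ltnS leq_eqVlt => /orP[/eqP ji|]; last exact: wb.
  by have -> : j = i; [apply: val_inj | rewrite ip eqxx].
have [ki|ik] := leqP k i; last first.
  exists w; split=> // j; rewrite ltnS leq_eqVlt => /orP[/eqP ji _|]; last exact: wb.
  by have -> : j = i; [apply: val_inj | have [] := sw i ik].
have pi : p != i by rewrite eq_sym.
have [[sap sbp] [sai sbi]] : (supported k (ea p) /\ supported k (eb p)) /\
    (supported k (ea i) /\ supported k (eb i)).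
  by split; apply: supported_basis; rewrite ?pk.
have kill : forall (x y : int) u, om (ea p) u = 0 -> om (eb p) u = 0 -> om (ea i) u = 0 ->
    om (eb i) u = 0 -> exists d : int, orb k (x *: ea p + y *: ea i + u) (d *: ea p + u).
  have oppr_unit (n : int) : n = 1 \/ n = -1 -> - n = 1 \/ - n = -1.
    by case=> ->; [right | left; rewrite opprK].
  apply: euclid_ind => [n x y n1 IH|n x y n1 IH|d] u pa pb ia ib.
  - have [d o] := IH u pa pb ia ib; exists d; apply: orb_trans o.
    have pq0 : om (ea p) (eb i) = 0 by rewrite om_ab (negPf pi).
    have := orb_eich (x *: ea p + y *: ea i + u) (oppr_unit _ n1) pq0
      (generated_eich_ab pi (Ha i) (Hb i) (Haa pi)) sap sbi.
    rewrite !omE !omB ?(negPf pi) ?(negPf ip) pa ib /=.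
    by congr orb; move: (ea p) (ea i) (eb i) => a b c; vec_ring.
  - have [d o] := IH u pa pb ia ib; exists d; apply: orb_trans o.
    have pq0 : om (ea i) (eb p) = 0 by rewrite om_ab (negPf ip).
    have := orb_eich (x *: ea p + y *: ea i + u) (oppr_unit _ n1) pq0
      (generated_eich_ab ip (Ha p) (Hb p) (Haa ip)) sai sbp.
    rewrite !omE !omB ?(negPf pi) ?(negPf ip) ia pb /=.
    by congr orb; move: (ea p) (ea i) (eb p) => a b c; vec_ring.
  - by exists d; rewrite scale0r addr0; apply: orb_refl.
pose x := om w (eb p); pose y := om w (eb i).
have [d o] : exists d : int, orb k
    (x *: ea p + y *: ea i + (w - x *: ea p - y *: ea i))
    (d *: ea p + (w - x *: ea p - y *: ea i)).
  apply: kill; rewrite !omE !omB ?(negPf pi) ?(negPf ip) ?wa /x /y ?(om_sym w) /=; ring.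
exists (d *: ea p + (w - x *: ea p - y *: ea i)); split.
- apply: orb_trans ovw _; move: o; congr orb.
  by move: (ea p) (ea i) => a b; vec_ring.
- by move=> j; rewrite !omE !omB wa; ring.
move=> j; rewrite ltnS leq_eqVlt !omE !omB => /orP[/eqP ji|jm] jp.
  have -> : j = i by apply: val_inj.
  by rewrite eqxx (negPf ip) /y (om_sym w) /=; ring.
rewrite wb // (negPf jp); have -> : (j == i) = false by apply/negbTE; rewrite neq_ltn jm.
by rewrite /=; ring.
Qed.


Lemma fixes_all A : fixes g A -> A = 1%g.
Proof. by move=> fA; apply: act_eq => i; rewrite act1; have [] := fA i (ltn_ord i). Qed.

(** The image of [ea p] is reduced to [d *: ea p]. It pairs to 1 with the image of [eb p], so [d] is
    a unit, and [hexa p ^+ 3] corrects the sign. *)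
Lemma fix_first (p : 'I_g) A : fixes p A -> exists B,
  [/\ H B, fixes p (B * A)%g & act (B * A)%g (ea p) = ea p].
Proof.
move=> fA.
have sv : supported p (act A (ea p)).
  move=> i ip; have [fa fb] := fA i ip; rewrite -{1}fa -{1}fb !om_act !omB.
  by have -> : (i == p) = false by apply/negbTE; rewrite neq_ltn ip.
have [w [o1 w0]] := orb_clear_b sv.
have [d o2] := orb_clear_a (erefl _) (orb_supported o1 sv) w0.
have [B [HB fB Bv]] := orb_trans o1 o2.
have fBA : fixes p (B * A)%g.
  by move=> i ip; rewrite !actM; have [-> ->] := fA i ip; apply: fB.
have d1 : om (ea p) (act (B * A)%g (eb p)) * d = 1.
  by rewrite mulrC -omZl -Bv -actM om_act om_ab1.
have /orP[/eqP dE|/eqP dE] : (d == 1) || (d == -1) by exact: intUnitRing.unitzPl d1.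
  by exists B; split=> //; rewrite actM Bv dE scale1r.
exists (hexa p ^+ 3 * B)%g; split.
  - by apply: generated_mul => //; apply/generatedX/generated_hexa.
  - move=> i ip; have pi0 : (p == i) = false by apply/negbTE; rewrite neq_ltn ip orbT.
    have [fa fb] := fBA i ip; rewrite -mulgA !(actM (_ ^+ 3)%g) fa fb.
    by rewrite !act_expg_fix // act_hexa_fix // !omB ?pi0 ?oppr0.
  - by rewrite -mulgA (actM (_ ^+ 3)%g) (actM B) Bv dE actZ act_hexa3_a scaleN1r opprK.
Qed.

(** As [ea p] is fixed, [eb p] goes to [eb p + x *: ea p + r] with [r] orthogonal to plane [p]. An
    Eichler transformation removes [r], a transvection the remaining multiple of [ea p]. *)
Lemma fix_second (p : 'I_g) A : fixes p A -> act A (ea p) = ea p -> exists B,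
  H B /\ fixes p.+1 (B * A)%g.
Proof.
move=> fA Ap; set w := act A (eb p).
have aw : om (ea p) w = 1 by rewrite -Ap om_act om_ab1.
pose x := om w (eb p); pose r := w - eb p - x *: ea p.
have ar : om (ea p) r = 0 by rewrite !omE !omB aw; ring.
have br : om (eb p) r = 0 by rewrite !omE !omB om_sym -/x; ring.
have aNr : om (ea p) (- r) = 0 by rewrite omE ar oppr0.
pose B1 := eich (ea p) (- r).
have rw : om r w = x * -1 - om (eb p) w.
  by rewrite !omE omxx aw sub0r; ring.
have B1w : exists y : int, act B1 w = eb p + y *: ea p.
  exists (x + om (- r) w); rewrite act_eich // aw scale1r scalerDl /r.
  by vec_ring.
have [y B1wE] := B1w.
exists (transv (- y) (ea p) * B1)%g; split.
  apply: generated_mul; first exact: generated_transv.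
  by apply: generated_eich_span => //; rewrite omNr br oppr0.
move=> i; rewrite ltnS leq_eqVlt => /orP[/eqP ip|ip].
  have -> : i = p by apply: val_inj.
  have B1p : act B1 (ea p) = ea p.
    by rewrite act_eich // omxx (om_sym (ea p)) aNr oppr0 !scale0r !addr0.
  rewrite !(actM _ A) Ap -/w !(actM _ B1) B1wE B1p !act_transv !omE !omB.
  by split; move: (ea p) (eb p) => a b; vec_ring.
have pi0 : (p == i) = false by apply/negbTE; rewrite neq_ltn ip orbT.
have ip0 : (i == p) = false by rewrite eq_sym.
have [fa fb] := fA i ip; rewrite !(actM _ A) fa fb !(actM _ B1).
have [wa wb] : om (ea i) w = 0 /\ om (eb i) w = 0.
  by rewrite -fa -fb !om_act !omB ip0.
have [ra rb] : om r (ea i) = 0 /\ om r (eb i) = 0.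
  by rewrite !omE !omB !(om_sym _ w) wa wb pi0 /=; split; ring.
have B1x z : om (ea p) z = 0 -> om r z = 0 -> act B1 z = z.
  by move=> az rz; rewrite act_eich // az omNl rz oppr0 !scale0r !addr0.
by rewrite !B1x ?transv_fix ?omB ?pi0.
Qed.

(** Induction on the number [k] of planes not yet fixed. *)
Theorem elementary_generation A : H A.
Proof.
suff gen k : (k <= g)%N -> forall B, fixes (g - k) B -> H B.
  by apply: (gen g (leqnn g)) => i; rewrite subnn.
elim: k => [|k IHk] kg B fB.
  by rewrite subn0 in fB; rewrite (fixes_all fB); apply: generated_one.
have pg : (g - k.+1 < g)%N by lia.
have [C [HC fC Cp]] := @fix_first (Ordinal pg) B fB.
have [D [HD fD]] := fix_second fC Cp.
apply: (generated_cancel HC); apply: (generated_cancel HD).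
by apply: IHk; [lia | move: fD; rewrite /= (_ : (g - k.+1).+1 = (g - k)%N) //; lia].
Qed.

End ElementaryGeneration.

(** * From rotations and a mixing element to the whole group *)

Section Conjugation.
Local Open Scope group_scope.
Lemma conj_expg (G : groupType) (x y : G) k : x * y ^+ k * x^-1 = (x * y * x^-1) ^+ k.
Proof.
elim: k => [|k IHk]; first by rewrite mulg1 mulgV.
by rewrite !expgS -IHk !mulgA mulgVK.
Qed.

Lemma conj_mulg (G : groupType) (x y z : G) :
  x * (y * z) * x^-1 = (x * y * x^-1) * (x * z * x^-1).
Proof. by rewrite !mulgA mulgVK. Qed.

Lemma conj_divg (G : groupType) (x y z : G) :
  x * (y * z^-1) * x^-1 = (x * y * x^-1) * (x * z * x^-1)^-1.
Proof. by rewrite conj_mulg !invgM !invgK !mulgA. Qed.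

Lemma mulg_commuteAC (G : groupType) (x y z t : G) :
  commute y z -> x * y * (z * t) = x * z * (y * t).
Proof. by move=> yz; rewrite -mulgA (mulgA y) yz !mulgA. Qed.

(** As [t] exchanges [x] and [y], the two factors are [y * x^-1 * t] and [t * y * x^-1], and the two
    [t] cancel. *)
Lemma swap_commutator (G : groupType) (x y t : G) : t * t = 1 -> t * x * t^-1 = y ->
  commute x y -> ((y * t * y^-1) * (x * t * x^-1)) ^+ 2 = y ^+ 4 * (x ^+ 4)^-1.
Proof.
move=> tt xy cxy; have tV : t^-1 = t by apply: mulg1_eq.
have -> : y * t * y^-1 * (x * t * x^-1) = (y * x^-1) ^+ 2.
  have xt : x * t = t * y by rewrite -xy tV !mulgA tt mul1g.
  have yt : t * y^-1 = x^-1 * t.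
    by rewrite -xy tV !invgM tV !mulgA tt mul1g.
  rewrite expg2 -!mulgA; congr (_ * _); rewrite mulgA yt -mulgA; congr (_ * _).
  by rewrite [x * _]mulgA xt !mulgA tt mul1g.
by rewrite -expgnA expgnFl //; apply: commute_sym.
Qed.

(** A conjugate of [hexa i] depends only on the images of [ea i] and [eb i], so a complicated
    conjugator can be traded for a simple one. *)
Lemma hexa_conj_eq g (A B : Sp g) i :
  act A (ea i) = act B (ea i) -> act A (eb i) = act B (eb i) ->
  A * hexa i * A^-1 = B * hexa i * B^-1.
Proof.
move=> Ea Eb; rewrite /hexa -!lock.
by rewrite !conj_mulg !transv_conj Ea Eb.
Qed.

Lemma hexaX_conj_eq g (A B : Sp g) i k :
  act A (ea i) = act B (ea i) -> act A (eb i) = act B (eb i) ->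
  A * hexa i ^+ k * A^-1 = B * hexa i ^+ k * B^-1.
Proof. by move=> Ea Eb; rewrite !conj_expg (hexa_conj_eq Ea Eb). Qed.

Lemma perm_hexaX g (s : 'S_g) i k :
  perm_sp s * hexa i ^+ k * (perm_sp s)^-1 = hexa (s i) ^+ k.
Proof. by rewrite conj_expg perm_hexa. Qed.

(** Permutations compose from left to right, matrices from right to left. *)
Lemma perm_spM g (s t : 'S_g) : perm_sp s * perm_sp t = perm_sp (t * s).
Proof. by apply: act_eq => i; rewrite actM !(act_perm_a, act_perm_b) permM. Qed.

Lemma perm_sp1 g : perm_sp (1 : 'S_g) = 1.
Proof. by apply: act_eq => i; rewrite act1 !(act_perm_a, act_perm_b) perm1. Qed.

Lemma perm_spV g (s : 'S_g) : (perm_sp s)^-1 = perm_sp s^-1.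
Proof. by apply: mulg1_eq; rewrite perm_spM mulVg perm_sp1. Qed.

(** Opposite rotations of order 3 in two planes, the form in which [swap_commutator] delivers
    them. *)
Definition hexrot g (i j : 'I_g) : Sp g := hexa i ^+ 4 * (hexa j ^+ 4)^-1.

Lemma perm_hexrot g (s : 'S_g) i j :
  perm_sp s * hexrot i j * (perm_sp s)^-1 = hexrot (s i) (s j).
Proof. by rewrite /hexrot conj_divg !perm_hexaX. Qed.

Lemma act_invg g (A : Sp g) v w : act A w = v -> act A^-1 v = w.
Proof. by move<-; rewrite actVK. Qed.

Lemma hexrot_act_a g (i j : 'I_g) : i != j -> act (hexrot i j) (ea i) = eb i.
Proof.
move=> ij; rewrite actM (@act_invg _ _ _ (ea i)) ?act_hexa4_a //.
by rewrite act_expg_fix // act_hexa_fix // !omB // eq_sym (negPf ij) ?oppr0.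
Qed.

Lemma hexrot_act_b g (i j : 'I_g) : i != j -> act (hexrot i j) (eb i) = (- ea i - eb i)%R.
Proof.
move=> ij; rewrite actM (@act_invg _ _ _ (eb i)) ?act_hexa4_b //.
by rewrite act_expg_fix // act_hexa_fix // !omB // eq_sym (negPf ij) ?oppr0.
Qed.

Lemma hexrot_fix g (i j k : 'I_g) : i != k -> j != k ->
  act (hexrot i j) (ea k) = ea k /\ act (hexrot i j) (eb k) = eb k.
Proof.
move=> ik jk; split; rewrite actM.
  by rewrite (@act_invg _ _ _ (ea k)) act_expg_fix // act_hexa_fix
    ?omB // (negPf ik, negPf jk) ?oppr0.
by rewrite (@act_invg _ _ _ (eb k)) act_expg_fix // act_hexa_fix
    ?omB // (negPf ik, negPf jk) ?oppr0.
Qed.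

End Conjugation.

(** * Dihedral symmetry of the cycle of indices *)

Section Cyclic.
Local Open Scope ring_scope.
Variable n : nat.
Local Notation g := n.+1.
Implicit Types (i j c d : 'I_g).

(* Indices are added modulo [g] through the group structure of ['I_n.+1]. *)
Definition idx k : 'I_g := inZp k.

Lemma idxS k : idx k.+1 = idx k + idx 1.
Proof. by apply: val_inj; rewrite /= modnDm addn1. Qed.

Lemma idx0 : idx 0 = 0.
Proof. by apply: val_inj; rewrite /= mod0n. Qed.

Lemma idx_val i : idx i = i.
Proof. exact: valZpK. Qed.

Definition refl_perm c : 'S_g := perm (can_inj (subKr c)).
Definition refl_sp c : Sp g := perm_sp (refl_perm c).

Lemma act_refl_a c i : act (refl_sp c) (ea i) = ea (c - i).
Proof. by rewrite act_perm_a permE. Qed.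
Lemma act_refl_b c i : act (refl_sp c) (eb i) = eb (c - i).
Proof. by rewrite act_perm_b permE. Qed.

Definition shift_perm d : 'S_g := (refl_perm 0 * refl_perm d)%g.

Lemma shift_permE d i : shift_perm d i = d + i.
Proof. by rewrite permM !permE sub0r opprK. Qed.

Variable S : seq (Sp g).
Local Notation H := (generated S).

(** Conjugating the reflection at [k] by the one at [k + 1] gives the one at [k + 2]. *)
Lemma generated_refl : H (refl_sp (idx 0)) -> H (refl_sp (idx 1)) -> forall c, H (refl_sp c).
Proof.
move=> H0 H1 c; rewrite -(idx_val c).
suff: H (refl_sp (idx c)) /\ H (refl_sp (idx c.+1)) by case.
elim: (c : nat) => {c} [|k [IH IH1]]; first by [].
split=> //.
have -> : refl_sp (idx k.+2) = (refl_sp (idx k.+1) * (refl_sp (idx k) * refl_sp (idx k.+1)))%g.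
  rewrite /refl_sp !perm_spM; congr perm_sp; apply/permP => i.
  rewrite !permM !permE (idxS k.+1) (idxS k); move: (idx k) (idx 1) => x y.
  by rewrite [- (x - _)]opprB [x + y - i - x]addrAC [x + y]addrC addrK addrA.
by do 2?apply: generated_mul.
Qed.


Hypothesis Hrefl : forall c, H (refl_sp c).

Definition shift_sp d : Sp g := perm_sp (shift_perm d).

Lemma generated_shift d : H (shift_sp d).
Proof. by rewrite /shift_sp /shift_perm -perm_spM; apply: generated_mul; apply: Hrefl. Qed.

Lemma act_shift_a d i : act (shift_sp d) (ea i) = ea (d + i).
Proof. by rewrite act_perm_a shift_permE. Qed.
Lemma act_shift_b d i : act (shift_sp d) (eb i) = eb (d + i).
Proof. by rewrite act_perm_b shift_permE. Qed.

(** Shifts carry the given rotation to every adjacent pair, and products of adjacent ones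
    telescope. *)
Lemma generated_rot c : H (hexrot c (c + idx 1)) -> forall i j, H (hexrot i j).
Proof.
move=> Hc.
have step i : H (hexrot i (i + idx 1)).
  have := generated_conj (generated_shift (i - c)) Hc.
  by rewrite perm_hexrot !shift_permE addrA subrK.
move=> i j; rewrite -[j](subrKC i) -[j - i]idx_val.
elim: (nat_of_ord _) => [|k IHk].
  by rewrite idx0 addr0 /hexrot mulgV; apply: generated_one.
rewrite (idxS k) addrA; have := generated_mul IHk (step (i + idx k)).
by rewrite /hexrot mulgA mulgVK.
Qed.

(** * From one rotation and a mixing element to all elementary elements *)

Section Core.
Hypothesis n_ge2 : (2 <= n)%N.
Variables (c : 'I_g) (z : Sp g).
Hypothesis Hrot : H (hexrot c (c + idx 1)).
Hypothesis Hz : H z.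
Local Notation a k := (ea (idx k)).
Local Notation b k := (eb (idx k)).
(** Only the action on planes 1 and 2 is prescribed, so both [flip] and its product with a disjoint
    twist qualify. *)
Hypothesis za1 : act z (a 1) = a 1 - a 0.
Hypothesis zb1 : act z (b 1) = b 1.
Hypothesis za2 : act z (a 2) = a 2.
Hypothesis zb2 : act z (b 2) = b 2.

Let neq (k l : nat) : (k < 3)%N -> (l < 3)%N -> (idx k == idx l) = (k == l).
Proof.
move=> k3 l3; rewrite -val_eqE /= !modn_small //; exact: leq_trans n_ge2.
Qed.

(* The commutator of [z] with [hexrot 1 2], as [z] agrees with
   [eich (a 0) (b 1)] on the planes of indices 1 and 2. *)
Lemma generated_mixed01 : H (eich (a 0) (b 1) * (eich (a 0) (- a 1 - b 1))^-1)%g.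
Proof.
have HX : H (hexrot (idx 1) (idx 2)) by apply: generated_rot Hrot _ _.
have := generated_mul (generated_conj Hz HX) (generated_inv HX).
set E := eich (a 0) (b 1).
have ab : om (a 0) (b 1) = 0 by rewrite om_ab neq.
have E1 : (z * hexa (idx 1) ^+ 4 * z^-1 = E * hexa (idx 1) ^+ 4 * E^-1)%g.
  by apply: hexaX_conj_eq; rewrite ?za1 ?zb1 act_eich // !omB ?neq //=
    ?oppr0 ?scale0r ?addr0 ?scaleN1r //.
have E2 : (z * hexa (idx 2) ^+ 4 * z^-1 = hexa (idx 2) ^+ 4)%g.
  by rewrite (@hexaX_conj_eq _ z 1%g) ?act1 // mul1g invg1 mulg1.
set N1 := (hexa (idx 1) ^+ 4)%g in E1 *; set N2 := (hexa (idx 2) ^+ 4)%g in E2 *.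
have -> : (z * hexrot (idx 1) (idx 2) * z^-1 * (hexrot (idx 1) (idx 2))^-1 =
    (z * N1 * z^-1) * (z * N2 * z^-1)^-1 * N2 * N1^-1)%g.
  by rewrite /hexrot -/N1 -/N2 !invgM !invgK !mulgA !mulgVK.
rewrite E1 E2 mulgVK.
have -> : (E * N1 * E^-1 * N1^-1 = E * (N1 * E * N1^-1)^-1)%g.
  by rewrite !invgM !invgK !mulgA.
by rewrite eich_conj act_hexa4_b act_expg_fix // act_hexa_fix // ?omB ?neq ?oppr0 //.
Qed.

(* Reflecting [generated_mixed01] about index 1 and commuting with [z] leaves a
   single short root element, since [z] moves [a 1] by [- a 0]. *)
Lemma generated_eich20 : H (eich (a 2) (a 0)).
Proof.
set x := - a 1 - b 1; pose P2 := (eich (a 2) (b 1) * (eich (a 2) x)^-1)%g.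
have HP2 : H P2.
  (* The reflection with parameter 2 fixes index 1 and exchanges 0 and 2. *)
  have := generated_conj (Hrefl (idx 2)) generated_mixed01.
  rewrite conj_divg !eich_conj !actE !(act_refl_a, act_refl_b).
  have -> : idx 2 - idx 0 = idx 2 by rewrite idx0 subr0.
  by have -> : idx 2 - idx 1 = idx 1 by rewrite (idxS 1) addrK.
(* [z] fixes [a 2] and [b 1] and sends [x] to [a 0 + x], so all factors cancel except the inverse of
   [eich (a 2) (a 0)]. *)
have := generated_mul (generated_inv HP2) (generated_conj Hz HP2).
rewrite conj_divg !eich_conj za2 zb1 /P2 !actE za1 zb1.
have -> : - (a 1 - a 0) - b 1 = a 0 + x by rewrite /x; move: (a 1) (a 0) (b 1) => p q r; vec_ring.
have [xa xb] : om (a 2) x = 0 /\ om (a 0) x = 0.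
  by rewrite !omE !omB !neq // oppr0.
rewrite eich_add ?omB //.
rewrite !invgM invgK !mulgA mulgVK mulgV mul1g.
by move/generated_inv; rewrite invgK.
Qed.

(** The rotation of planes 0 and 1 fixes plane 2 and cycles [a 0], [b 0] and [- (a 0 + b 0)]; a
    rotation of plane 2 then carries [a 2] to [b 2]. *)
Lemma generated_transv2 : H (transv 1 (a 2)) /\ H (transv 1 (b 2)).
Proof.
have HX := generated_rot Hrot.
have [r2a r2b] : act (hexrot (idx 0) (idx 1)) (a 2) = a 2 /\
    act (hexrot (idx 0) (idx 1)) (b 2) = b 2.
  by apply: hexrot_fix; rewrite neq.
have n01 : idx 0 != idx 1 by rewrite neq.
have H1 : H (eich (a 2) (b 0)).
  have := generated_conj (HX (idx 0) (idx 1)) generated_eich20.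
  by rewrite eich_conj r2a hexrot_act_a.
have H2 : H (eich (a 2) (- (a 0 + b 0))).
  have := generated_conj (HX (idx 0) (idx 1)) H1.
  by rewrite eich_conj r2a hexrot_act_b // opprD.
have Ha : H (transv 1 (a 2)).
  have o1 : om (a 2) (a 0) = 0 by rewrite omB.
  have o2 : om (a 2) (b 0) = 0 by rewrite omB neq.
  (* [a 0], [b 0] and [- (a 0 + b 0)] sum to zero, but do not commute in the
     Heisenberg group of [a 2]: the defect is a transvection. *)
  have := generated_mul H2 (generated_mul generated_eich20 H1).
  by rewrite eichD // -eichV ?omE ?o1 ?o2 // mulgA mulVg mul1g om_ab1.
split=> //; have := generated_conj (HX (idx 2) (idx 0)) Ha.
by rewrite transv_conj hexrot_act_a // neq.
Qed.

Lemma core_generation A : H A.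
Proof.
have [Ha2 Hb2] := generated_transv2.
have Ha i : H (transv 1 (ea i)).
  have := generated_conj (generated_shift (i - idx 2)) Ha2.
  by rewrite transv_conj act_shift_a subrK.
have Hb i : H (transv 1 (eb i)).
  have := generated_conj (generated_shift (i - idx 2)) Hb2.
  by rewrite transv_conj act_shift_b subrK.
have H01 : H (eich (a 0) (a 1)).
  have := generated_mixed01.
  have o1 : om (a 0) (b 1) = 0 by rewrite omB neq.
  have o2 : om (a 0) (- a 1 - b 1) = 0 by rewrite !omE !omB neq.
  have o3 : om (a 0) (- (- a 1 - b 1)) = 0 by rewrite omNr o2 oppr0.
  rewrite eichV // eichD // => HP.
  have H1 : H (eich (a 0) (b 1 - (- a 1 - b 1))).
    have := generated_mul HP (generated_inv (generated_transv
      (om (b 1) (- (- a 1 - b 1))) (Ha (idx 0)))).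
    by rewrite mulgK.
  (* [H1] concerns [a 1 + 2 *: b 1], which this transvection sends to [a 1]. *)
  have := generated_conj (generated_transv 2 (Hb (idx 1))) H1.
  rewrite eich_conj transv_fix ?act_transv ?omE ?omB ?neq ?oppr0 //; congr (H (eich _ _)).
  by move: (a 1) (b 1) => p q; vec_ring.
have step i : H (eich (ea i) (ea (i + idx 1))).
  have := generated_conj (generated_shift (i - idx 0)) H01.
  by rewrite eich_conj !act_shift_a idx0 subr0 addr0.
have all_k i k : (0 < k < g)%N -> H (eich (ea i) (ea (i + idx k))).
  elim: k => [//|[|k] IHk] lek; first exact: step.
  rewrite (idxS k.+1) addrA; set j := i + idx k.+1; set l := j + idx 1.
  have ij : i != j.
    rewrite /j -subr_eq0 opprD addrA subrr sub0r oppr_eq0 -val_eqE /=.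
    by rewrite modn_small //; lia.
  have il : i != l.
    rewrite /l /j -addrA -(idxS k.+1) -subr_eq0 opprD addrA subrr sub0r oppr_eq0 -val_eqE /=.
    by rewrite modn_small //; lia.
  have jl : j != l.
    rewrite /l -subr_eq0 opprD addrA subrr sub0r oppr_eq0 -val_eqE /=.
    by rewrite modn_small //; lia.
  have Hij : H (eich (ea i) (eb j)) by apply: generated_eich_ab => //; apply: IHk; lia.
  (* The conjugator sends [ea j] to [ea j - ea i] and fixes [ea l]; cancelling the part with [ea j]
     extends the distance by one. *)
  have := generated_conj Hij (step j).
  have oij : om (ea i) (eb j) = 0 by rewrite omB (negPf ij).
  rewrite eich_conj !act_eich // !omB ?(negPf jl) ?oppr0 !scale0r !addr0 scaleN1r -/l.
  rewrite eichC ?omE ?omB ?oppr0 // eich_add ?omE ?omB ?oppr0 //.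
  move=> Hm; have := generated_cancel _ Hm; rewrite eichC ?omB // => /(_ (step j)).
  rewrite -eichV ?omB // => /generated_inv; rewrite invgK eichC ?omB //.
apply: elementary_generation => // i j ij.
rewrite -[j](subrKC i) -[j - i]idx_val; apply: all_k.
rewrite ltn_ord andbT lt0n; apply: contra ij => /eqP ji0.
have : j - i = 0 by apply: val_inj.
by move/eqP; rewrite subr_eq0 eq_sym.
Qed.

End Core.
End Cyclic.

(** * The involutions *)

Section Involutions.
Local Open Scope group_scope.
Variable g : nat.
Implicit Types (i j k p q : 'I_g) (A B : Sp g).

(** A conjugate of the swap of two planes, hence an involution; its mirror image [twist j i] is
    conjugated by [hexa i] instead. *)
Definition twist i j : Sp g := hexa j * perm_sp (tperm i j) * (hexa j)^-1.
(** For distinct indices, [hexa p ^+ 3] negates plane [p] and so inverts the short root element by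
    conjugation, which makes the product an involution. *)
Definition flip p q : Sp g := eich (ea p) (eb q) * hexa p ^+ 3.

Lemma twist_sqr i j : twist i j ^+ 2 = 1.
Proof.
rewrite /twist -(conj_expg (hexa j)) (expg2 (perm_sp _)).
by rewrite perm_spM tperm2 perm_sp1 mulg1 mulgV.
Qed.

Lemma hexa_commute i j : commute (hexa i) (hexa j).
Proof.
have [->//|ij] := eqVneq i j.
have fix_b : act (hexa i) (eb j) = eb j by rewrite act_hexa_fix // ?omB // (negPf ij) ?oppr0.
have fix_a : act (hexa i) (ea j) = ea j by rewrite act_hexa_fix // ?omB // (negPf ij) ?oppr0.
by rewrite {2}/hexa -lock; apply: commuteM; apply: fix_commute.
Qed.

Lemma perm_twist (s : 'S_g) i j :
  perm_sp s * twist i j * (perm_sp s)^-1 = twist (s i) (s j).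
Proof.
have E : tperm (s i) (s j) = s^-1 * (tperm i j * s) by rewrite -tpermJ.
rewrite /twist E -(perm_hexa s j) -!perm_spM -perm_spV.
by rewrite !invgM !invgK !mulgA !mulgVK.
Qed.

Lemma twist_rot i j : (twist i j * twist j i) ^+ 2 = hexrot j i.
Proof.
rewrite /twist [tperm j i]tpermC; apply: swap_commutator.
- by rewrite perm_spM tperm2 perm_sp1.
- by rewrite perm_hexa tpermL.
- exact: hexa_commute.
Qed.

Lemma twist_fix i j k : k != i -> k != j ->
  act (twist i j) (ea k) = ea k /\ act (twist i j) (eb k) = eb k.
Proof.
move=> ki kj; have [jk ik] : j != k /\ i != k by rewrite (eq_sym j) (eq_sym i).
have ha : act (hexa j) (ea k) = ea k by rewrite act_hexa_fix ?omB // (negPf jk) ?oppr0.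
have hb : act (hexa j) (eb k) = eb k by rewrite act_hexa_fix ?omB // (negPf jk) ?oppr0.
by rewrite /twist !actM (act_invg ha) (act_invg hb) act_perm_a act_perm_b tpermD // ha hb.
Qed.

Lemma act_twist_a i j : i != j -> act (twist i j) (ea i) = (- eb j)%R.
Proof.
move=> ij; rewrite /twist !actM (@act_invg _ _ _ (ea i)); last first.
  by rewrite act_hexa_fix ?omB // eq_sym (negPf ij) ?oppr0.
by rewrite act_perm_a tpermL act_hexa_a.
Qed.

Lemma act_flip p q : p != q ->
  [/\ act (flip p q) (ea p) = (- ea p)%R, act (flip p q) (eb p) = (- (eb p + eb q))%R,
      act (flip p q) (ea q) = (ea q - ea p)%R & act (flip p q) (eb q) = eb q].
Proof.
move=> pq; have o : om (ea p) (eb q) = 0%R by rewrite omB (negPf pq).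
have [ha hb] : act (hexa p ^+ 3) (ea q) = ea q /\ act (hexa p ^+ 3) (eb q) = eb q.
  by split; rewrite act_expg_fix // act_hexa_fix ?omB // (negPf pq) ?oppr0.
rewrite /flip !(actM (eich _ _)) ha hb act_hexa3_a act_hexa3_b !act_eich //.
rewrite !omE !omB ?(eq_sym q) ?(negPf pq).
by split; move: (ea p) (eb p) (ea q) (eb q) => a b c d /=; vec_ring.
Qed.

(** [flip p q] is built from transvections along combinations of these three vectors. *)
Lemma commute_flip A p q : act A (ea p) = ea p -> act A (eb p) = eb p ->
  act A (eb q) = eb q -> commute A (flip p q).
Proof.
move=> Aap Abp Abq; have cT v m : act A v = v -> commute A (transv m v) by apply: fix_commute.
apply: commuteM.
  by rewrite /commute -[in RHS]Aap -[in RHS]Abq -eich_conj mulgVK.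
by apply: commuteX; rewrite /hexa -lock; apply: commuteM; apply: cT.
Qed.

Lemma flip_fix p q k : p != q -> k != p -> k != q ->
  act (flip p q) (ea k) = ea k /\ act (flip p q) (eb k) = eb k.
Proof.
move=> pq kp kq; have [pk qk] : p != k /\ q != k by rewrite (eq_sym p) (eq_sym q).
have o : om (ea p) (eb q) = 0%R by rewrite omB (negPf pq).
have ha : act (hexa p) (ea k) = ea k by rewrite act_hexa_fix ?omB // (negPf pk) ?oppr0.
have hb : act (hexa p) (eb k) = eb k by rewrite act_hexa_fix ?omB // (negPf pk) ?oppr0.
rewrite /flip !(actM (eich _ _)) !act_expg_fix // !act_eich //.
by rewrite !omB (negPf pk) (negPf qk) oppr0 !scale0r !addr0.
Qed.

Lemma flip_sqr p q : p != q -> flip p q ^+ 2 = 1.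
Proof.
move=> pq; have [fap fbp faq fbq] := act_flip pq.
apply: act_eq => k; rewrite act1 expg2 actM.
all: have [->|kp] := eqVneq k p; first by rewrite ?fap ?fbp !actE ?fap ?fbp ?fbq;
  move: (ea p) (eb p) (eb q) => a b c; vec_ring.
all: have [->|kq] := eqVneq k q; first by rewrite ?faq ?fbq ?actE ?faq ?fap ?fbq ?opprK ?subrK.
all: have [fa fb] := flip_fix pq kp kq; by rewrite ?fa ?fb.
Qed.

Lemma perm_flip (s : 'S_g) p q :
  perm_sp s * flip p q * (perm_sp s)^-1 = flip (s p) (s q).
Proof.
rewrite /flip -perm_hexaX -act_perm_a -act_perm_b -eich_conj !mulgA.
by rewrite !mulgVK.
Qed.

End Involutions.

(** * The explicit generating involutions *)

Section Generators.
Variable n : nat.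
Local Notation g := n.+1.
Local Notation ix := (idx n).
Local Open Scope group_scope.

Lemma idx_eq k l : k < g -> l < g -> (ix k == ix l) = (k == l).
Proof. by move=> kg lg; rewrite -val_eqE /= !modn_small. Qed.

Lemma idxB k l : l <= k -> (ix k - ix l)%R = ix (k - l).
Proof.
move=> lk; rewrite -{1}(subnK lk); move: (k - l) => m {k lk}.
elim: l => [|l IHl]; first by rewrite addn0 idx0 subr0.
by rewrite addnS (idxS n (m + l)) (idxS n l) opprD addrACA subrr addr0.
Qed.

Lemma refl_sqr (c : 'I_g) : refl_sp c ^+ 2 = 1.
Proof.
rewrite expg2 perm_spM; suff -> : refl_perm c * refl_perm c = 1 by rewrite perm_sp1.
by apply/permP => i; rewrite permM perm1 !permE subKr.
Qed.

(** Negation moves index 1, as 2 is nonzero modulo [g]. A separate argument is given because [probe]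
    takes the same value here as at 1. *)
Lemma refl_neq1 : 2 < g -> refl_sp (ix 0) != 1.
Proof.
move=> g2; apply/eqP => /(congr1 (fun A => om (act A (ea (ix 1))) (eb (ix 1)))).
rewrite act_refl_a act1 !omB idx0 sub0r.
suff -> : (- ix 1 == ix 1)%R = false by [].
by rewrite eq_sym -addr_eq0 -idxS -(idx0 n) idx_eq.
Qed.

(* The images of [a_0], read off in the coordinates of [a_0] and [a_1],
   tell the chosen involutions apart. *)
Definition probe (A : Sp g) : int * int :=
  (om (act A (ea (ix 0))) (eb (ix 0)), om (act A (ea (ix 0))) (eb (ix 1))).

Lemma probe1 : 1 < g -> probe 1 = (1, 0)%R.
Proof. by move=> g1; rewrite /probe !act1 !omB idx_eq. Qed.

Lemma probe_refl0 : 1 < g -> probe (refl_sp (ix 0)) = (1, 0)%R.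
Proof. by move=> g1; rewrite /probe !act_refl_a subrr -(idx0 n) !omB idx_eq. Qed.

Lemma probe_refl1 : 1 < g -> probe (refl_sp (ix 1)) = (0, 1)%R.
Proof. by move=> g1; rewrite /probe !act_refl_a idxB // subn0 !omB idx_eq. Qed.

Lemma involution_neq1 (A : Sp g) : A != 1 -> A ^+ 2 = 1 -> involution A.
Proof. by move=> A1 A2; rewrite /involution /= A1 A2 eqxx. Qed.

Lemma probe_neq1 A : 1 < g -> probe A != (1, 0)%R -> A != 1.
Proof. by move=> g1; apply: contraNneq => ->; rewrite probe1. Qed.

Lemma four_involutions : 3 <= g -> generated_by_involutions (Sp g) 4.
Proof.
move=> g3; have g1 : 1 < g by apply: ltnW.
have n01 : ix 0 != ix 1 by rewrite idx_eq.
pose t := twist (ix 0) (ix 1); pose f := flip (ix 0) (ix 1).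
have [fa0 _ fa1 fb1] := act_flip n01.
have probe_t : probe t = (0, 0)%R by rewrite /probe act_twist_a // !omE !omB.
have probe_f : probe f = (-1, 0)%R by rewrite /probe fa0 !omE !omB idx_eq.
exists [tuple refl_sp (ix 0); refl_sp (ix 1); t; f]; split.
- apply: (@map_uniq _ _ probe).
  by rewrite /= probe_t probe_f probe_refl0 ?probe_refl1.
- apply/and5P; split=> //; apply: involution_neq1; rewrite ?refl_sqr ?twist_sqr ?flip_sqr ?refl_neq1 //.
  + by apply: probe_neq1; rewrite ?probe_refl1.
  + by apply: probe_neq1; rewrite ?probe_t.
  + by apply: probe_neq1; rewrite ?probe_f.
set S := tval _; have HS x : x \in S -> generated S x by apply: generated_mem.
have Hrefl : forall c, generated S (refl_sp c).
  by apply: generated_refl; apply: HS; rewrite !inE eqxx ?orbT.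
have Ht : generated S t by apply: HS; rewrite !inE eqxx ?orbT.
have Hf : generated S f by apply: HS; rewrite !inE eqxx ?orbT.
have Hrot : generated S (hexrot (ix 1) (ix 0)).
  rewrite -twist_rot; apply/generatedX/generated_mul => //.
  (* The reflection with parameter 1 exchanges 0 and 1 and so gives the mirror image of [t]. *)
  have := generated_conj (Hrefl (ix 1)) Ht.
  by rewrite perm_twist !permE !idxB.
have [||fa2 fb2] := flip_fix (k := ix 2) n01; rewrite ?idx_eq //.
apply: (@core_generation n S Hrefl _ (ix 0) f) => //; rewrite ?fa1 ?fb1 //.
by have := generated_inv Hrot; rewrite /hexrot invgM invgK -idxS.
Qed.

(** [flip] on planes 0, 1 and [twist] on planes 3, 4 commute and merge into one involution [z],
    which acts like [flip] on planes 1 and 2. *)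
Lemma three_involutions : 8 <= g -> generated_by_involutions (Sp g) 3.
Proof.
move=> g8; have g1 : 1 < g by apply: leq_trans g8.
have neq k l : k < 8 -> l < 8 -> (ix k == ix l) = (k == l).
  by move=> k8 l8; apply: idx_eq; apply: leq_trans g8.
have n01 : ix 0 != ix 1 by rewrite neq.
pose t := twist (ix 3) (ix 4); pose f := flip (ix 0) (ix 1); pose z := f * t.
have [fa0 _ fa1 fb1] := act_flip n01.
have tfix k : k < 8 -> k != 3 -> k != 4 ->
    act t (ea (ix k)) = ea (ix k) /\ act t (eb (ix k)) = eb (ix k).
  by move=> k8 k3 k4; apply: twist_fix; rewrite neq.
have ffix k : 1 < k < 8 -> act f (ea (ix k)) = ea (ix k) /\ act f (eb (ix k)) = eb (ix k).
  by case: k => [|[|k]]// k8; apply: flip_fix; rewrite ?neq.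
have [[ta0 tb0] [ta1 tb1]] := (tfix 0%N isT isT isT, tfix 1%N isT isT isT).
have ctf : commute t f by apply: commute_flip.
have zz : z ^+ 2 = 1 by rewrite /z expgMn ?flip_sqr ?twist_sqr ?mulg1 //; apply: commute_sym.
have probe_z : probe z = (-1, 0)%R by rewrite /probe !(actM f t) ta0 fa0 !omE !omB neq.
exists [tuple refl_sp (ix 0); refl_sp (ix 1); z]; split.
- apply: (@map_uniq _ _ probe).
  by rewrite /= probe_z probe_refl0 ?probe_refl1.
- apply/and4P; split=> //; apply: involution_neq1; rewrite ?refl_sqr ?refl_neq1 //.
  + by apply: leq_trans g8.
  + by apply: probe_neq1; rewrite ?probe_refl1.
  + by apply: probe_neq1; rewrite ?probe_z.
set S := tval _; have HS x : x \in S -> generated S x by apply: generated_mem.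
have Hrefl : forall c, generated S (refl_sp c).
  by apply: generated_refl; apply: HS; rewrite !inE eqxx ?orbT.
have Hz : generated S z by apply: HS; rewrite !inE eqxx ?orbT.
have Hrot : generated S (hexrot (ix 4) (ix 3)).
  (* The reflection with parameter 7 exchanges 3 and 4 and takes 0, 1 to 7, 6, clear of the other
     supports. The two flips commute with everything here and vanish on squaring. *)
  have := generatedX 2 (generated_mul Hz (generated_conj (Hrefl (ix 7)) Hz)).
  pose t' := twist (ix 4) (ix 3); pose f' := flip (ix 7) (ix 6).
  have -> : refl_sp (ix 7) * z * (refl_sp (ix 7))^-1 = f' * t'.
    by rewrite conj_mulg perm_flip perm_twist !permE !idxB.
  have [[ta7 tb7] [ta6 tb6]] := (tfix 7 isT isT isT, tfix 6 isT isT isT).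
  have [[fa7 fb7] [fa6 fb6]] := (ffix 7 isT, ffix 6 isT).
  have tfix' k : k < 8 -> k != 3 -> k != 4 ->
      act t' (ea (ix k)) = ea (ix k) /\ act t' (eb (ix k)) = eb (ix k).
    by move=> k8 k3 k4; apply: twist_fix; rewrite neq.
  have [[ua0 ub0] [ua1 ub1]] := (tfix' 0%N isT isT isT, tfix' 1%N isT isT isT).
  have [[ua7 ub7] [ua6 ub6]] := (tfix' 7 isT isT isT, tfix' 6 isT isT isT).
  have ctf' : commute t f' by apply: commute_flip.
  have cuf : commute t' f by apply: commute_flip.
  have cuf' : commute t' f' by apply: commute_flip.
  have cff' : commute f f' by apply: commute_flip.
  have n76 : ix 7 != ix 6 by rewrite neq.
  rewrite /z (mulg_commuteAC f _ ctf').
  rewrite expgMn; last first.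
    by apply: commute_sym; apply: commuteM; apply: commute_sym;
      apply: commuteM => //; apply: commute_sym.
  by rewrite (expgMn _ cff') !flip_sqr // !mul1g twist_rot.
apply: (@core_generation n S Hrefl _ (ix 3) z) => //; rewrite ?(actM f t).
- exact: (leq_trans _ (g8 : 7 <= n)).
- by have := generated_inv Hrot; rewrite /hexrot invgM invgK -idxS.
- by rewrite ta1 fa1.
- by rewrite tb1 fb1.
- by have [-> _] := tfix 2 isT isT isT; have [-> _] := ffix 2 isT.
- by have [_ ->] := tfix 2 isT isT isT; have [_ ->] := ffix 2 isT.
Qed.

End Generators.

Theorem corollary2 (g : nat) :
  (8 <= g -> generated_by_involutions (Sp g) 3) /\
  (3 <= g -> generated_by_involutions (Sp g) 4).
Proof.
case: g => [//|n]; split; [exact: three_involutions | exact: four_involutions].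
Qed.
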